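(* Let $n\ge 1$, let $a_{i,j}$ ($1\le i\le j\le n$) and $b_{i,j}$ ($1\le i<j\le n$) be complex indeterminates, and let $M_F$ and $M_B$ be the $n\times n$ matrices $$(M_{F})_{i,j} = \begin{cases} a_{i,j} + b_{i,j} & i < j, \\ a_{j,i} - b_{j,i} & i > j, \\ a_{i,i} & i=j, \end{cases}\qquad (M_{B})_{i,j} = \begin{cases} a_{i,j} + \sqrt{-1}\, b_{i,j} & i < j, \\ a_{j,i} - \sqrt{-1}\, b_{j,i} & i > j, \\ a_{i,i} & i=j. \end{cases}$$ Then $$\det(M_F) = \sum_{\mu \in (\mathcal{B}_{F})_n} (-1)^{\chi(\mu)} w(\mu),\qquad \det(M_B) = (-1)^{\binom{n}{2}}\sum_{\mu \in (\mathcal{B}_{B})_n} (-1)^{\chi(\mu)}w(\mu),$$ where $(\mathcal{B}_F)_n$ and $(\mathcal{B}_B)_n$ are the sets of $F$-Brauer and $B$-Brauer diagrams of size $n$, $\chi$ is the crossing number and $w$ is the weight.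
   Context: Place $2n$ vertices in two horizontal rows, a top row $T$ and a bottom row $B$, each with $n$ vertices. An (unlabeled) Brauer diagram $\mu$ of size $n$ is a perfect matching of these $2n$ vertices, drawn in the strip between the two rows. An edge joining two vertices of $T$ is a cup, an edge joining two vertices of $B$ is a cap, and an edge joining a vertex of $T$ to a vertex of $B$ is an arc. The drawing is such that two caps, or two cups, meet in at most one point; a cap and a cup do not meet; an arc meets any other arc, cap or cup in at most one point. The crossing number $\chi(\mu)$ is the number of pairwise intersections among edges of $\mu$. Equivalently, in terms of positions from left to right in each row: two cups (or two caps) cross if and only if their endpoints interleave; a cup (resp. cap) and an arc cross if and only if the top (resp. bottom) endpoint of the arc lies strictly between the two endpoints of the cup (resp. cap); two arcs cross if and only if the left-to-right order of their top endpoints is opposite to that of their bottom endpoints; a cup and a cap never cross. Labelings: the vertices of $T$ are always labeled $1,\dots,n$ from left to right. In an $F$-Brauer diagram the vertices of $B$ are labeled $1,\dots,n$ from left to right; in a $B$-Brauer diagram they are labeled $1,\dots,n$ from right to left. $(\mathcal{B}_F)_n$ and $(\mathcal{B}_B)_n$ denote the sets of all $F$-Brauer, respectively $B$-Brauer, diagrams of size $n$. For a labeled diagram $\mu$, let $\mu_T$, $\mu_B$, $\mu_{TB}$ be its sets of cups, caps and arcs, written as ordered pairs of labels: cups and caps are written $(i,j)$ with $i<j$; arcs are written with the top label first. Put $(\widehat{i,j})=(\min(i,j),\max(i,j))$. The weight of $\mu$ is $$w(\mu) = \prod_{(i,j) \in \mu_T} b_{i,j} \prod_{(i,j) \in \mu_B}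 b_{i,j} \prod_{(i,j) \in \mu_{TB}} a_{\widehat{i,j}}.$$ *)

(* Defs.v *)
From HB Require Import structures.
From mathcomp Require Export all_boot all_order all_algebra.
From mathcomp Require Export reals.
From mathcomp Require Export complex.
From mathcomp Require Export mpoly.

Set Implicit Arguments.
Unset Strict Implicit.
Unset Printing Implicit Defensive.

Import GRing.Theory.
Local Open Scope ring_scope.

(* A vertex is named by its row ([inl] for the top row T, [inr] for the bottom
   row B) and by its position in that row, counted from the left from 0. *)
Definition vertex (n : nat) : finType := ('I_n + 'I_n)%type.

Definition top {n} (i : 'I_n) : vertex n := inl i.
Definition bot {n} (i : 'I_n) : vertex n := inr i.

Definition is_brauer {n} (mu : {set {set vertex n}}) : bool :=
  partition mu [set: vertex n] && [forall e in mu, #|e| == 2].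

(* The vertices of a diagram are positions, so the F- and the B-Brauer diagrams
   of size [n] are the elements of this set with, in addition, one of the two
   labelings of the bottom row given by [bot_label] below. *)
Definition brauer (n : nat) : {set {set {set vertex n}}} :=
  [set mu | is_brauer mu].

(* The crossings forced by the drawing rules: two edges meet in at most one
   point, and a cup never meets a cap, so there is no clause for that case.
   Each clause fixes the order in which the two edges are listed; [chi] only
   uses the unordered pair {e, f}. *)
Definition cups_cross {n} (e f : {set vertex n}) : bool :=
  [exists i : 'I_n, exists j : 'I_n, exists k : 'I_n, exists l : 'I_n,
    [&& i < j, j < k, k < l,
        e == [set top i; top k] & f == [set top j; top l]]]%N.

Definition caps_cross {n} (e f : {set vertex n}) : bool :=
  [exists i : 'I_n, exists j : 'I_n, exists k : 'I_n, exists l : 'I_n,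
    [&& i < j, j < k, k < l,
        e == [set bot i; bot k] & f == [set bot j; bot l]]]%N.

Definition cup_arc_cross {n} (e f : {set vertex n}) : bool :=
  [exists i : 'I_n, exists j : 'I_n, exists k : 'I_n, exists l : 'I_n,
    [&& i < j, j < k,
        e == [set top i; top k] & f == [set top j; bot l]]]%N.

Definition cap_arc_cross {n} (e f : {set vertex n}) : bool :=
  [exists i : 'I_n, exists j : 'I_n, exists k : 'I_n, exists l : 'I_n,
    [&& i < j, j < k,
        e == [set bot i; bot k] & f == [set top l; bot j]]]%N.

Definition arcs_cross {n} (e f : {set vertex n}) : bool :=
  [exists i : 'I_n, exists j : 'I_n, exists k : 'I_n, exists l : 'I_n,
    [&& i < j, l < k,
        e == [set top i; bot k] & f == [set top j; bot l]]]%N.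

Definition cross {n} (e f : {set vertex n}) : bool :=
  [|| cups_cross e f, caps_cross e f, cup_arc_cross e f, cap_arc_cross e f
    | arcs_cross e f].

Definition chi {n} (mu : {set {set vertex n}}) : nat :=
  #|[set [set e; f] | e in mu, f in mu & cross e f]|.

Variant labeling := Flab | Blab.

(* The bottom vertex carrying a given label: labels increase from left to right
   in an F-Brauer diagram, from right to left in a B-Brauer diagram. *)
Definition bot_label {n} (L : labeling) (i : 'I_n) : vertex n :=
  match L with Flab => bot i | Blab => bot (rev_ord i) end.

Definition cups {n} (mu : {set {set vertex n}}) : {set 'I_n * 'I_n} :=
  [set p : 'I_n * 'I_n | (p.1 < p.2)%N & [set top p.1; top p.2] \in mu].

Definition caps {n} (L : labeling) (mu : {set {set vertex n}}) :
    {set 'I_n * 'I_n} :=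
  [set p : 'I_n * 'I_n | (p.1 < p.2)%N
     & [set bot_label L p.1; bot_label L p.2] \in mu].

Definition arcs {n} (L : labeling) (mu : {set {set vertex n}}) :
    {set 'I_n * 'I_n} :=
  [set p : 'I_n * 'I_n | [set top p.1; bot_label L p.2] \in mu].

Definition hat {n} (p : 'I_n * 'I_n) : 'I_n * 'I_n :=
  if (p.1 <= p.2)%N then p else (p.2, p.1).

Definition weight {A : comNzRingType} {n} (a b : 'I_n -> 'I_n -> A)
    (L : labeling) (mu : {set {set vertex n}}) : A :=
  (\prod_(p in cups mu) b p.1 p.2) * (\prod_(p in caps L mu) b p.1 p.2) *
  (\prod_(p in arcs L mu) a (hat p).1 (hat p).2).

Definition mat_F {A : comNzRingType} {n} (a b : 'I_n -> 'I_n -> A) : 'M[A]_n :=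
  \matrix_(i < n, j < n)
    if (i < j)%N then a i j + b i j
    else if (j < i)%N then a j i - b j i
    else a i i.

(* [I] is the square root of -1. *)
Definition mat_B {A : comNzRingType} {n} (I : A) (a b : 'I_n -> 'I_n -> A) :
    'M[A]_n :=
  \matrix_(i < n, j < n)
    if (i < j)%N then a i j + I * b i j
    else if (j < i)%N then a j i - I * b j i
    else a i i.

(* The indeterminates: a_{i,j} for i <= j and b_{i,j} for i < j. *)
Definition var (n : nat) : finType :=
  ({p : 'I_n * 'I_n | (p.1 <= p.2)%N} + {p : 'I_n * 'I_n | (p.1 < p.2)%N})%type.

Definition polyring (R : realType) (n : nat) : comNzRingType :=
  {mpoly R[i][#|var n|]}.

(* The value 0 outside of the index range is junk: [mat_F], [mat_B] and [weight]
   only read [Xa] at i <= j and [Xb] at i < j. *)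
Definition Xa (R : realType) (n : nat) (i j : 'I_n) : polyring R n :=
  if insub (i, j) is Some p then 'X_(enum_rank (inl p : var n)) else 0.

Definition Xb (R : realType) (n : nat) (i j : 'I_n) : polyring R n :=
  if insub (i, j) is Some p then 'X_(enum_rank (inr p : var n)) else 0.

Definition sqrtm1 (R : realType) (n : nat) : polyring R n :=
  ('i%C : R[i])%:MP.

(* Main.v *)
(* The right-hand side is a Pfaffian: [chi] counts the crossing chords when the
   2n vertices are read along a circle (top row left to right, then bottom row
   right to left). With S the symmetric matrix of the a's, K the skew matrix of
   the b's and M = S + c K, the skew matrix of that Pfaffian is, up to the order
   of the vertices, [[K, S], [-S, -c^2 K]], with c = 1 in the F case and
   c = sqrt(-1) in the B case. This matrix is W J W^T for the standard symplectic
   form J and a W with det W = det M, so its Pfaffian is det M up to a sign; the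
   reversed labels of the B case account for (-1)^binom(n,2). The Pfaffian is
   handled as a sum over all permutations, which counts every diagram the same
   number of times; this multiplicity is cancelled at the end. *)
From mathcomp Require Import all_fingroup ring zify.
Require Import Defs.

Set Implicit Arguments.
Unset Strict Implicit.
Unset Printing Implicit Defensive.

Import GRing.Theory Num.Theory.
Local Open Scope ring_scope.

(** * The Pfaffian as a sum over permutations *)

(** For skew [N] this is [2^n n!] times the Pfaffian, up to the sign caused by pairing [k] with
    [n + k]. *)
Definition pfsum (A : comNzRingType) n (N : 'M[A]_(n + n)) : A :=
  \sum_(s : 'S_(n + n)) (-1) ^+ s * \prod_k N (s (lshift n k)) (s (rshift n k)).

Lemma split_lshift m n (k : 'I_m) : split (lshift n k) = inl k.
Proof. exact: (unsplitK (inl k)). Qed.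

Lemma split_rshift m n (k : 'I_n) : split (rshift m k) = inr k.
Proof. exact: (unsplitK (inr k)). Qed.

(** Expanding the entries of [W N W^T] chooses an index pair [f k] for each [k]; summing over [s]
    first leaves a determinant made of columns of [W]. It vanishes unless the chosen indices form a
    permutation, and then it is [det W] up to the sign of that permutation. *)
Lemma pfsum_congr (A : comNzRingType) n (W N : 'M[A]_(n + n)) :
  pfsum (W *m N *m W^T) = \det W * pfsum N.
Proof.
pose J := ('I_(n + n) * 'I_(n + n))%type.
pose c (f : {ffun 'I_n -> J}) : {ffun 'I_(n + n) -> 'I_(n + n)} :=
  [ffun x => match split x with inl k => (f k).1 | inr k => (f k).2 end].
have cl f k : c f (lshift n k) = (f k).1 by rewrite ffunE split_lshift.
have cr f k : c f (rshift n k) = (f k).2 by rewrite ffunE split_rshift.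
pose d (t : 'S_(n + n)) : {ffun 'I_n -> J} :=
  [ffun k => (t (lshift n k), t (rshift n k))].
have cd t : c (d t) = pval t.
  by apply/ffunP=> x; case: (split_ordP x) => k ->; rewrite ?cl ?cr ffunE -pvalE.
have detc f : \sum_(s : 'S_(n + n)) (-1) ^+ s * \prod_x W (s x) (c f x) =
    \det (\matrix_(x, y) W y (c f x)).
  by apply: eq_bigr => s _; congr (_ * _); apply: eq_bigr => x _; rewrite mxE.
transitivity (\sum_(f : {ffun 'I_n -> J}) (\prod_k N (f k).1 (f k).2) *
                \det (\matrix_(x, y) W y (c f x))).
  transitivity (\sum_(s : 'S_(n + n)) \sum_(f : {ffun 'I_n -> J})
     (\prod_k N (f k).1 (f k).2) * ((-1) ^+ s * \prod_x W (s x) (c f x))).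
    apply: eq_bigr => s _.
    pose F k (uv : J) := N uv.1 uv.2 *
      (W (s (lshift n k)) uv.1 * W (s (rshift n k)) uv.2).
    transitivity ((-1) ^+ s * \prod_k \sum_uv F k uv).
      congr (_ * _); apply: eq_bigr => k _.
      rewrite -(pair_bigA _ (fun u v => F k (u, v))) exchange_big mxE.
      apply: eq_bigr => v _; rewrite !mxE big_distrl.
      by apply: eq_bigr => u _; rewrite /F /=; ring.
    rewrite bigA_distr_bigA big_distrr /=; apply: eq_bigr => f _.
    rewrite /F big_split /= big_split_ord /= mulrCA.
    congr (_ * (_ * _)); rewrite big_split /=.
    by congr (_ * _); apply: eq_bigr => k _; rewrite ?cl ?cr.
  rewrite exchange_big /=; apply: eq_bigr => f _.
  by rewrite -big_distrr /= detc.
rewrite (bigID (fun f : {ffun _ -> J} => injectiveb (c f))) /= addrC.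
rewrite big1 ?add0r => [|f]; last first.
  case/injectivePn=> i1 [i2 Di12 Ef12].
  by rewrite (determinant_alternate Di12) ?mulr0 // => j; rewrite !mxE Ef12.
rewrite (reindex d) /=; last first.
  exists (fun f : {ffun _ -> J} => insubd (1%g : 'S_(n + n)) (c f)) => [t _ | f Uf].
    by apply: val_inj; rewrite cd; apply: insubdK; apply: (valP t).
  set t : 'S_(n + n) := insubd _ _.
  have E : pval t = c f by apply: insubdK.
  by apply/ffunP=> k; rewrite ffunE -!pvalE E cl cr -surjective_pairing.
rewrite /pfsum big_distrr /=; apply: eq_big => [t|t _].
  by rewrite cd (valP t).
have -> : (\matrix_(x, y) W y (c (d t) x)) = row_perm t W^T.
  by apply/matrixP=> x y; rewrite !mxE cd pvalE.
rewrite row_permE det_mulmx det_perm det_tr mulrC -mulrA mulrCA; congr (_ * (_ * _)).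
by apply: eq_bigr => k _; rewrite ffunE.
Qed.

Definition std_sympl (A : comNzRingType) n : 'M[A]_(n + n) :=
  block_mx 0 1%:M (- 1%:M) 0.

(* The block matrix is the congruence transform [W J W^T] of the standard
   symplectic form [J] for
   [W = [[1,0],[-c,1]] * [[1,0],[0,M^T]] * [[1,X],[0,1]]], where [M = S + c K]. *)
Lemma pfsum_block (A : comNzRingType) n (c : A) (S X : 'M[A]_n) :
  S^T = S -> let K := X^T - X in
  pfsum (block_mx K S (- S) (- (c ^+ 2) *: K)) =
  \det (S + c *: K) * pfsum (std_sympl A n).
Proof.
move=> symS K; set M := S + c *: K.
have KT : K^T = - K by rewrite /K linearB /= trmxK opprB.
have MT : M^T = S - c *: K by rewrite linearD linearZ /= symS KT scalerN.
pose L : 'M[A]_(n + n) := block_mx 1%:M 0 (- c%:M) 1%:M.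
pose D : 'M[A]_(n + n) := block_mx 1%:M 0 0 M^T.
pose U : 'M[A]_(n + n) := block_mx 1%:M X 0 1%:M.
have detL : \det (L *m D *m U) = \det M.
  by rewrite !det_mulmx !det_lblock det_ublock !det1 det_tr !mul1r mulr1.
rewrite -{}detL -pfsum_congr; congr pfsum.
rewrite !trmx_mul !mulmxA -(mulmxA _ U) -(mulmxA _ (U *m _)).
have -> : U *m std_sympl A n *m U^T = block_mx K 1%:M (- 1%:M) 0.
  rewrite /U /std_sympl tr_block_mx !mulmx_block !trmx1 !trmx0.
  rewrite !(mulmx0, mul0mx, mulmx1, mul1mx, mulmxN, mulNmx, add0r, addr0, oppr0).
  by rewrite addrC.
rewrite -(mulmxA L D) -(mulmxA L (D *m _)).
have -> : D *m block_mx K 1%:M (- 1%:M) 0 *m D^T = block_mx K M (- M^T) 0.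
  rewrite /D tr_block_mx !mulmx_block !trmx1 !trmx0 trmxK.
  by rewrite !(mulmx0, mul0mx, mulmx1, mul1mx, mulmxN, mulNmx, add0r, addr0, oppr0).
have cT : (- c%:M)^T = - c%:M :> 'M[A]_n by rewrite linearN /= tr_scalar_mx.
rewrite /L tr_block_mx !mulmx_block !trmx1 !trmx0 cT.
rewrite !(mulmx0, mul0mx, mulmx1, mul1mx, mulmxN, mulNmx, add0r, addr0, oppr0).
rewrite !mul_scalar_mx !mul_mx_scalar MT.
congr block_mx; apply/matrixP=> i j; rewrite !mxE; ring.
Qed.

(** * Signs of permutations and parity of crossings *)

(** Both inversion products are signs of integer Vandermonde determinants, at the values [p j] and
    [p (s j)]; permuting the columns by [s] turns the first matrix into the second. *)
Lemma perm_sign_prod m (p : 'I_m -> nat) (s : 'S_m) : injective p ->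
  (-1) ^+ s * \prod_(i < m) \prod_(j < m | (i < j)%N) (-1) ^+ (p j < p i)%N =
  \prod_(i < m) \prod_(j < m | (i < j)%N) (-1) ^+ (p (s j) < p (s i))%N :> int.
Proof.
move=> pinj.
have V (q : 'I_m -> int) : \prod_(i < m) \prod_(j < m | (i < j)%N) (q j - q i) =
    \det (Vandermonde m (\row_j q j)).
  by rewrite det_Vandermonde; do 2!apply: eq_bigr => ? _; rewrite !mxE.
have sgE (q : 'I_m -> nat) : injective q ->
    \prod_(i < m) \prod_(j < m | (i < j)%N) (-1) ^+ (q j < q i)%N =
    Num.sg (\det (Vandermonde m (\row_j (q j)%:Z))).
  move=> qinj; rewrite -V (big_morph _ (@sgrM int) (@sgr1 int)).
  apply: eq_bigr => i _; rewrite (big_morph _ (@sgrM int) (@sgr1 int)).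
  apply: eq_bigr => j ij; case: ltngtP => [lt|lt|/qinj E].
  - by rewrite ltr0_sg // subr_lt0 ltz_nat.
  - by rewrite gtr0_sg // subr_gt0 ltz_nat.
  - by rewrite E ltnn in ij.
rewrite (sgE _ pinj) (sgE (p \o s)); last by apply: inj_comp => //; apply: perm_inj.
have -> : Vandermonde m (\row_j (((p \o s) j)%:Z)) =
    col_perm s (Vandermonde m (\row_j (p j)%:Z)).
  by apply/matrixP=> i j; rewrite !mxE.
rewrite col_permE det_mulmx det_perm odd_permV sgrM mulrC; congr (_ * _).
by case: (odd_perm s); rewrite ?expr1 ?expr0 ?sgrN sgr1.
Qed.

(* Rank of a vertex in the circular order that reads the top row from left to
   right, then the bottom row from right to left: [chi] counts the crossing
   chords for this order. *)
Definition pos n (v : vertex n) : nat :=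
  match v with inl i => i | inr j => n + rev_ord j end.

Lemma pos_inj n : injective (@pos n).
Proof.
move=> [i|i] [j|j] /= E.
- by congr inl; apply: val_inj.
- by have := ltn_ord i; lia.
- by have := ltn_ord j; lia.
- by congr inr; apply: val_inj => /=; have := ltn_ord i; have := ltn_ord j; lia.
Qed.

(** Parity of the four comparisons between ends of two chords. For distinct vertices it is odd
    exactly when one of [v1], [v2] lies between [u1] and [u2] and the other does not; the
    exclusive-or form becomes a product of signs. *)
Definition interleave n (u1 u2 v1 v2 : vertex n) : bool :=
  (pos v1 < pos u1)%N (+) (pos v2 < pos u1)%N (+)
  ((pos v1 < pos u2)%N (+) (pos v2 < pos u2)%N).

(** A permutation is read as [n] ordered, oriented chords, the [k]-th going from the image of [k] to
    the image of [n + k]. *)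
Definition lend n (s : 'S_(n + n)) (k : 'I_n) : vertex n := split (s (lshift n k)).
Definition rend n (s : 'S_(n + n)) (k : 'I_n) : vertex n := split (s (rshift n k)).

Lemma lend_inj n (s : 'S_(n + n)) : injective (lend s).
Proof. by move=> i j /(can_inj splitK) /perm_inj /lshift_inj. Qed.

Lemma rend_inj n (s : 'S_(n + n)) : injective (rend s).
Proof. by move=> i j /(can_inj splitK) /perm_inj /rshift_inj. Qed.

Lemma lend_neq_rend n (s : 'S_(n + n)) i j : lend s i != rend s j.
Proof.
by rewrite (can_eq splitK) (inj_eq perm_inj) eq_lrshift.
Qed.

Section PairProducts.

Variable R : comNzRingType.

(** Groups the pairs [x < y] by chords [{i, n + i}]: one pair inside each chord, four between two
    chords. *)
Lemma prod_lt_split n (F : 'I_(n + n) -> 'I_(n + n) -> R) :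
  \prod_(x < n + n) \prod_(y < n + n | (x < y)%N) F x y =
  \prod_(i < n) F (lshift n i) (rshift n i) *
  \prod_(i < n) \prod_(j < n | (i < j)%N)
    (F (lshift n i) (lshift n j) * F (rshift n i) (rshift n j) *
     (F (lshift n i) (rshift n j) * F (lshift n j) (rshift n i))).
Proof.
have square (G : 'I_n -> 'I_n -> R) : \prod_i \prod_j G i j =
    \prod_i G i i * \prod_(i < n) \prod_(j < n | (i < j)%N) (G i j * G j i).
  transitivity (\prod_(i < n) (G i i * (\prod_(j < n | (i < j)%N) G i j *
                  \prod_(j < n | (j < i)%N) G i j))).
    apply: eq_bigr => i _; rewrite (bigD1 i) //=; congr (_ * _).
    rewrite (bigID (fun j : 'I_n => (i < j)%N)) /=.
    by congr (_ * _); apply: eq_bigl => j; rewrite -val_eqE /=; lia.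
  rewrite big_split big_split /=; congr (_ * _).
  rewrite [X in _ * X](exchange_big_dep xpredT) //= -big_split /=.
  by apply: eq_bigr => i _; rewrite -big_split.
rewrite big_split_ord /=.
have -> : \prod_(i < n) \prod_(y < n + n | (lshift n i < y)%N) F (lshift n i) y =
    \prod_(i < n) \prod_(j < n | (i < j)%N) F (lshift n i) (lshift n j) *
    \prod_i \prod_j F (lshift n i) (rshift n j).
  rewrite -big_split; apply: eq_bigr => i _; rewrite big_split_ord /=.
  by congr (_ * _); apply: eq_bigl => j; have := ltn_ord i; rewrite /=; lia.
have -> : \prod_(i < n) \prod_(y < n + n | (rshift n i < y)%N) F (rshift n i) y =
    \prod_(i < n) \prod_(j < n | (i < j)%N) F (rshift n i) (rshift n j).
  apply: eq_bigr => i _; rewrite big_split_ord /= big1 ?mul1r => [|j]; last first.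
    by have := ltn_ord j; lia.
  by apply: eq_bigl => j; rewrite ltn_add2l.
rewrite square mulrAC mulrC -!mulrA; congr (_ * _).
rewrite mulrCA mulrA -big_split mulrC -big_split; apply: eq_bigr => i _ /=.
rewrite -!big_split; apply: eq_bigr => j _ /=; ring.
Qed.

(** This is [perm_sign_prod] for circular positions, grouped by chords: a chord contributes its
    orientation, two chords their interleaving. *)
Lemma matching_sign n (s : 'S_(n + n)) :
  (-1) ^+ s =
  \prod_k (-1) ^+ (pos (rend s k) < pos (lend s k))%N *
  \prod_(i < n) \prod_(j < n | (i < j)%N)
    (-1) ^+ interleave (lend s i) (rend s i) (lend s j) (rend s j) :> R.
Proof.
pose f (t : 'S_(n + n)) x y : R := (-1) ^+ (pos (split (t y)) < pos (split (t x)))%N.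
have E : (-1) ^+ s * \prod_(x < n + n) \prod_(y < n + n | (x < y)%N) f 1%g x y =
         \prod_(x < n + n) \prod_(y < n + n | (x < y)%N) f s x y.
  have := @perm_sign_prod _ (fun x : 'I_(n + n) => pos (split x)) s
    (inj_comp (@pos_inj n) (can_inj splitK)).
  move=> /(congr1 (fun z : int => z%:~R : R)).
  rewrite rmorphM rmorph_sign /= !rmorph_prod /= => H.
  rewrite [LHS](_ : _ = (-1) ^+ s * \prod_(i < n + n)
    (\prod_(j < n + n | (i < j)%N) (-1) ^+ (pos (split j) < pos (split i))%N)%:~R).
    rewrite H; apply: eq_bigr => x _; rewrite rmorph_prod.
    by apply: eq_bigr => y _; rewrite rmorph_sign.
  congr (_ * _); apply: eq_bigr => x _; rewrite rmorph_prod.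
  by apply: eq_bigr => y _; rewrite rmorph_sign /f !perm1.
move: E; rewrite !prod_lt_split.
(* One of the four comparisons between two chords is reversed in [interleave], which costs a factor
   -1 per pair of chords. The identity permutation yields the same product [P], so it cancels. *)
pose P : R := \prod_(i < n) \prod_(j < n | (i < j)%N) (-1).
have PP : P * P = 1.
  rewrite -big_split big1 //= => i _; rewrite -big_split big1 //= => j _.
  by rewrite mulrNN mulr1.
have -> : \prod_(i < n) f 1%g (lshift n i) (rshift n i) = 1.
  rewrite big1 // => k _; rewrite /f !perm1 split_lshift split_rshift /=.
  by have -> : (n + (n - k.+1) < k)%N = false by have := ltn_ord k; lia.
have -> : \prod_(i < n) \prod_(j < n | (i < j)%N)
    (f 1%g (lshift n i) (lshift n j) * f 1%g (rshift n i) (rshift n j) *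
     (f 1%g (lshift n i) (rshift n j) * f 1%g (lshift n j) (rshift n i))) = P.
  apply: eq_bigr => i _; apply: eq_bigr => j ij.
  rewrite /f !perm1 !split_lshift !split_rshift /=.
  have -> : (j < i)%N = false by lia.
  have -> : (n + (n - j.+1) < n + (n - i.+1))%N by have := ltn_ord j; lia.
  have -> : (n + (n - j.+1) < i)%N = false by have := ltn_ord i; lia.
  have -> : (n + (n - i.+1) < j)%N = false by have := ltn_ord j; lia.
  by rewrite expr0 expr1 mul1r !mulr1.
have -> : \prod_(i < n) \prod_(j < n | (i < j)%N)
    (f s (lshift n i) (lshift n j) * f s (rshift n i) (rshift n j) *
     (f s (lshift n i) (rshift n j) * f s (lshift n j) (rshift n i))) =
  P * \prod_(i < n) \prod_(j < n | (i < j)%N)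
    (-1) ^+ interleave (lend s i) (rend s i) (lend s j) (rend s j).
  rewrite -big_split; apply: eq_bigr => i _; rewrite -big_split.
  apply: eq_bigr => j ij.
  rewrite /f /interleave -/(lend s i) -/(lend s j) -/(rend s i) -/(rend s j) /=.
  have -> : (pos (rend s i) < pos (lend s j))%N =
      ~~ (pos (lend s j) < pos (rend s i))%N.
    have /negP := lend_neq_rend s j i; case: ltngtP => // /(@pos_inj n) ->.
    by rewrite eqxx.
  by rewrite !signr_addb signrN; ring.
rewrite mul1r => E; have -> : (-1) ^+ s = (-1) ^+ s * P * P by rewrite -mulrA PP mulr1.
by rewrite E -mulrA mulrAC PP mul1r.
Qed.

End PairProducts.

(** * Crossing edges as interleaving chords of a circle *)

Lemma set2_eq (T : finType) (a b c d : T) : [set a; b] = [set c; d] ->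
  (a = c /\ b = d) \/ (a = d /\ b = c).
Proof.
move/setP=> E; have := E a; have := E b; have := E c; have := E d.
rewrite !inE !eqxx ?orbT /= => /orP Ed /orP Ec /esym/orP Eb /esym/orP Ea.
case: Ea => /eqP Ea; case: Eb => /eqP Eb; subst; auto.
  by left; case: Ed => /eqP ->.
by right; case: Ec => /eqP ->.
Qed.

(** Every drawing rule becomes the same circular pattern [x, z, y, w], with bottom vertices met from
    right to left. The disjunction is there because [cross] fixes the order in which the edges are
    listed. *)
Lemma cross_pos n (e f : {set vertex n}) : cross e f ->
  exists x y z w : vertex n, [&& pos x < pos z, pos z < pos y & pos y < pos w]%N /\
    ((e = [set x; y] /\ f = [set z; w]) \/ (f = [set x; y] /\ e = [set z; w])).
Proof.
case/or4P=> [|||/orP[]] /existsP[i /existsP[j /existsP[k /existsP[l]]]].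
- case/and5P=> ij jk kl /eqP-> /eqP->.
  by exists (top i), (top k), (top j), (top l); rewrite /= ij jk kl; auto.
- case/and5P=> ij jk kl /eqP-> /eqP->.
  exists (bot l), (bot j), (bot k), (bot i); split; last first.
    by right; split; apply: setUC.
  by rewrite /=; have := ltn_ord l; have := ltn_ord k; have := ltn_ord j; lia.
- case/and4P=> ij jk /eqP-> /eqP->.
  exists (top i), (top k), (top j), (bot l); split; last by auto.
  by rewrite /= ij jk; have := ltn_ord k; lia.
- case/and4P=> ij jk /eqP-> /eqP->.
  exists (top l), (bot j), (bot k), (bot i); split; last first.
    by right; split=> //; apply: setUC.
  by rewrite /=; have := ltn_ord l; have := ltn_ord k; have := ltn_ord j; lia.
- case/and4P=> ij lk /eqP-> /eqP->.
  exists (top i), (bot k), (top j), (bot l); split; last by auto.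
  by rewrite /= ij; have := ltn_ord j; have := ltn_ord k; lia.
Qed.

(** Top vertices come first on the circle, so those among [x, z, y, w] form an initial segment; its
    five possible lengths give the five clauses of [cross]. *)
Lemma pos_cross n (x y z w : vertex n) :
  [&& pos x < pos z, pos z < pos y & pos y < pos w]%N ->
  cross [set x; y] [set z; w] || cross [set z; w] [set x; y].
Proof.
case/and3P=> xz zy yw.
have ex4 (P : 'I_n -> 'I_n -> 'I_n -> 'I_n -> bool) i j k l : P i j k l ->
    [exists i, exists j, exists k, exists l, P i j k l].
  move=> H; apply/existsP; exists i; apply/existsP; exists j.
  by apply/existsP; exists k; apply/existsP; exists l.
case: x xz => x; case: z zy => z; case: y yw => y; case: w => w /= yw zy xz;
  try (by have := ltn_ord z; have := ltn_ord y; have := ltn_ord w; lia).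
- apply/orP; left; apply/or4P/Or41.
  apply: (ex4 _ x z y w).
  by rewrite xz zy yw !eqxx.
- apply/orP; left; apply/or4P/Or43.
  apply: (ex4 _ x z y w).
  by rewrite xz zy !eqxx.
- apply/orP; left; apply/or4P/Or44/orP; right.
  apply: (ex4 _ x z y w).
  rewrite xz !eqxx !andbT /=; have := ltn_ord y; have := ltn_ord w; lia.
- apply/orP; right; apply/or4P/Or44/orP; left.
  apply: (ex4 _ w y z x).
  rewrite [X in [&& _, _, X == _ & _]]setUC !eqxx !andbT.
  by apply/andP; split; have := ltn_ord y; have := ltn_ord w; have := ltn_ord z; lia.
- apply/orP; right; apply/or4P/Or42.
  apply: (ex4 _ w y z x).
  rewrite [X in [&& _, _, _, X == _ & _]]setUC [X in [&& _, _, _, _ & X == _]]setUC.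
  rewrite !eqxx !andbT.
  have := ltn_ord y; have := ltn_ord w; have := ltn_ord z; have := ltn_ord x; lia.
Qed.

Lemma interleave_cross n (u1 u2 v1 v2 : vertex n) :
  uniq [:: u1; u2; v1; v2] ->
  cross [set u1; u2] [set v1; v2] || cross [set v1; v2] [set u1; u2] =
  interleave u1 u2 v1 v2.
Proof.
rewrite -(map_inj_uniq (@pos_inj n)) /= !inE !negb_or !andbT => U.
apply/idP/idP=> [C|].
  have [x [y [z [w [xzyw E]]]]] : exists x y z w : vertex n,
      [&& pos x < pos z, pos z < pos y & pos y < pos w]%N /\
      (([set u1; u2] = [set x; y] /\ [set v1; v2] = [set z; w]) \/
       ([set v1; v2] = [set x; y] /\ [set u1; u2] = [set z; w])).
    case/orP: C => /cross_pos[x [y [z [w [H E]]]]]; exists x, y, z, w; split=> //.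
    tauto.
  rewrite /interleave.
  by case: E => -[] /set2_eq [] [E1 E2] /set2_eq [] [E3 E4]; subst; lia.
have perm2 (x y z w : vertex n) :
    [&& pos x < pos z, pos z < pos y & pos y < pos w]%N ->
    [set u1; u2] = [set x; y] /\ [set v1; v2] = [set z; w] \/
    [set u1; u2] = [set z; w] /\ [set v1; v2] = [set x; y] ->
    cross [set u1; u2] [set v1; v2] || cross [set v1; v2] [set u1; u2].
  by move=> /pos_cross H [[-> ->]|[-> ->]] //; rewrite orbC.
rewrite /interleave => I.
have C12 := setUC [set u1] [set u2]; have C34 := setUC [set v1] [set v2].
case: (ltnP (pos u1) (pos u2)) => H1; case: (ltnP (pos v1) (pos v2)) => H2;
case: (ltnP (minn (pos u1) (pos u2)) (minn (pos v1) (pos v2))) => H3.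
- by apply: (perm2 u1 u2 v1 v2); [lia | auto].
- by apply: (perm2 v1 v2 u1 u2); [lia | auto].
- by apply: (perm2 u1 u2 v2 v1); [lia | auto].
- by apply: (perm2 v2 v1 u1 u2); [lia | auto].
- by apply: (perm2 u2 u1 v1 v2); [lia | auto].
- by apply: (perm2 v1 v2 u2 u1); [lia | auto].
- by apply: (perm2 u2 u1 v2 v1); [lia | auto].
- by apply: (perm2 v2 v1 u2 u1); [lia | auto].
Qed.

(** * Diagrams read off permutations *)

Definition edge n (s : 'S_(n + n)) (k : 'I_n) : {set vertex n} :=
  [set lend s k; rend s k].

Definition diagram n (s : 'S_(n + n)) : {set {set vertex n}} :=
  [set edge s k | k : 'I_n].

Lemma edge_inj n (s : 'S_(n + n)) : injective (edge s).
Proof.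
move=> i j /set2_eq [[/lend_inj //]|[E _]].
by have := lend_neq_rend s i j; rewrite E eqxx.
Qed.

Lemma edge_diagram n (s : 'S_(n + n)) k : edge s k \in diagram s.
Proof. by apply: imset_f. Qed.

Lemma card_diagram n (s : 'S_(n + n)) : #|diagram s| = n.
Proof. by rewrite card_imset ?card_ord //; apply: edge_inj. Qed.

Lemma cross_edge n (s : 'S_(n + n)) i j : i != j ->
  cross (edge s i) (edge s j) || cross (edge s j) (edge s i) =
  interleave (lend s i) (rend s i) (lend s j) (rend s j).
Proof.
move=> ij; apply: interleave_cross.
rewrite /= !inE !negb_or !lend_neq_rend (inj_eq (@lend_inj _ s)) ij.
by rewrite (inj_eq (@rend_inj _ s)) ij [_ == lend s j]eq_sym lend_neq_rend.
Qed.

(** [chi] counts sets [{e, f}] while the product runs over indices [i < j]; the map [h] matches the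
    two, no edge crossing itself. *)
Lemma chi_diagram (R : comNzRingType) n (s : 'S_(n + n)) :
  \prod_(i < n) \prod_(j < n | (i < j)%N)
    (-1) ^+ interleave (lend s i) (rend s i) (lend s j) (rend s j) =
  (-1) ^+ chi (diagram s) :> R.
Proof.
pose Q := [set p : 'I_n * 'I_n | (p.1 < p.2)%N &&
  interleave (lend s p.1) (rend s p.1) (lend s p.2) (rend s p.2)].
have -> : chi (diagram s) = #|Q|.
  pose h (p : 'I_n * 'I_n) := [set edge s p.1; edge s p.2].
  have hinj : {in Q &, injective h}.
    move=> [i j] [k l]; rewrite !inE /= => /andP[ij _] /andP[kl _].
    case/set2_eq=> /= -[] /edge_inj E1 /edge_inj E2; first by rewrite E1 E2.
    by subst; lia.
  rewrite -(card_in_imset hinj) /chi; apply: eq_card => X.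
  apply/imset2P/imsetP.
    case=> e f /imsetP[i _ ->]; rewrite inE => /andP[/imsetP[j _ ->] C ->].
    have ij : i != j.
      apply: contraTneq C => ->; apply/negP=> /cross_pos[x [y [z [w [H E]]]]].
      by case: E => -[] -> /set2_eq [] [E1 E2]; subst; lia.
    have I := cross_edge s ij; rewrite C in I.
    case: (ltngtP i j) => [lt|gt|/val_inj E]; last by rewrite E eqxx in ij.
      by exists (i, j); rewrite // inE lt -I.
    exists (j, i); last by rewrite /h setUC.
    by rewrite inE gt -cross_edge 1?eq_sym // C orbT.
  case=> -[i j]; rewrite inE /= => /andP[ij]; rewrite -cross_edge; last first.
    by apply: contraTneq ij => ->; rewrite ltnn.
  case/orP=> C ->.
    by exists (edge s i) (edge s j); rewrite ?inE ?edge_diagram.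
  by exists (edge s j) (edge s i); rewrite ?inE ?edge_diagram // /h setUC.
rewrite pair_big_dep /= GRing.prodrXr -sum1_card; congr (_ ^+ _).
rewrite [LHS]big_mkcond [RHS]big_mkcond /=.
by apply: eq_bigr => -[i j] _; rewrite inE /=; case: ltnP => //= _; case: interleave.
Qed.

Lemma diagram_brauer n (s : 'S_(n + n)) : diagram s \in brauer n.
Proof.
rewrite inE /is_brauer; apply/andP; split; last first.
  by apply/forall_inP=> _ /imsetP[k _ ->]; rewrite cards2 lend_neq_rend.
apply/and3P; split.
- apply/eqP/setP=> v; rewrite [RHS]inE; apply/bigcupP.
  have := permKV s (unsplit v); case: (split_ordP ((s^-1)%g (unsplit v))) => k -> E;
    exists (edge s k); rewrite ?edge_diagram //.
    by rewrite !inE /lend E unsplitK eqxx.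
  by rewrite !inE /rend E unsplitK eqxx orbT.
- apply/trivIsetP=> _ _ /imsetP[i _ ->] /imsetP[j _ ->] ij.
  have {}ij : i != j by apply: contraNneq ij => ->.
  rewrite -setI_eq0; apply/eqP/setP=> v; rewrite !inE; apply/negbTE/negP.
  case/andP=> /orP[]/eqP-> /orP[]; rewrite ?(negbTE (lend_neq_rend _ _ _)) //.
  + by rewrite (inj_eq (@lend_inj _ s)) (negbTE ij).
  + by rewrite eq_sym (negbTE (lend_neq_rend _ _ _)).
  + by rewrite (inj_eq (@rend_inj _ s)) (negbTE ij).
- apply/negP=> /imsetP[k _ /esym/eqP]; rewrite -cards_eq0 cards2.
  by rewrite lend_neq_rend.
Qed.

(** List the [n] edges and order the two ends of each. First ends on the left half of the indices
    and second ends on the right half give an injective map, as the edges are disjoint. *)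
Lemma brauer_diagram n (mu : {set {set vertex n}}) :
  mu \in brauer n -> exists s : 'S_(n + n), mu = diagram s.
Proof.
rewrite inE => /andP[part /forall_inP card2].
have cmu : #|mu| = n.
  have := card_uniform_partition (fun e emu => eqP (card2 e emu)) part.
  by rewrite cardsT card_sum card_ord; lia.
have [f fP] : exists f : 'I_n -> vertex n * vertex n, forall k,
    enum_val (cast_ord (esym cmu) k) = [set (f k).1; (f k).2] /\ (f k).1 != (f k).2.
  apply: (@fin_all_exists _ _ (fun k (p : vertex n * vertex n) =>
    enum_val (cast_ord (esym cmu) k) = [set p.1; p.2] /\ p.1 != p.2)) => k.
  have /cards2P[u [v [uv ->]]] := card2 _ (enum_valP (cast_ord (esym cmu) k)).
  by exists (u, v).
have disj i j v : v \in [set (f i).1; (f i).2] -> v \in [set (f j).1; (f j).2] -> i = j.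
  rewrite -(fP i).1 -(fP j).1 => vi vj; apply/eqP; apply: contraT => ij.
  have /and3P[_ /trivIsetP triv _] := part.
  have := triv _ _ (enum_valP (cast_ord (esym cmu) i))
    (enum_valP (cast_ord (esym cmu) j)).
  rewrite (inj_eq enum_val_inj) (inj_eq (@cast_ord_inj _ _ _)) => /(_ ij).
  by rewrite -setI_eq0 => /eqP/setP/(_ v); rewrite !inE vi vj.
pose g (x : 'I_(n + n)) : 'I_(n + n) :=
  unsplit match split x with inl k => (f k).1 | inr k => (f k).2 end.
have ginj : injective g.
  move=> x y /(can_inj unsplitK).
  case: (split_ordP x) => i ->; case: (split_ordP y) => j -> E.
  - by rewrite (disj i j (f i).1) ?E // !inE ?eqxx ?orbT // -E eqxx.
  - have ij : i = j by apply: (disj i j (f i).1); rewrite !inE ?E eqxx ?orbT.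
    by have := (fP j).2; rewrite -E ij eqxx.
  - have ij : i = j by apply: (disj i j (f i).2); rewrite !inE ?E eqxx ?orbT.
    by have := (fP j).2; rewrite -E ij eqxx.
  - by rewrite (disj i j (f i).2) // !inE ?E eqxx ?orbT.
exists (perm ginj); apply/esym/eqP; rewrite eqEcard card_diagram cmu leqnn andbT.
apply/subsetP=> _ /imsetP[k _ ->].
rewrite /edge /lend /rend !permE /g split_lshift split_rshift !unsplitK -(fP k).1.
exact: enum_valP.
Qed.

(** Products apply the left factor first, so right multiplication by [s] moves the vertices of a
    diagram. Hence the fibres of [diagram] are translates of one another. *)
Lemma diagram_mul n (t s : 'S_(n + n)) :
  diagram (t * s) =
  [set [set split (s (unsplit v)) | v in e] | e : {set vertex n} in diagram t].
Proof.
rewrite /diagram -imset_comp; apply: eq_imset => k /=.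
by rewrite imsetU1 imset_set1 /edge /lend /rend !permM !splitK.
Qed.

(** The number [2^n n!] of ways to order and orient the chords, a positive multiplicity common to
    all diagrams. *)
Definition diagram_mult n := #|[set s : 'S_(n + n) | diagram s == diagram 1%g]|.

Lemma diagram_mult_gt0 n : (0 < diagram_mult n)%N.
Proof. by apply/card_gt0P; exists 1%g; rewrite inE. Qed.

Lemma card_diagram_fiber n (s : 'S_(n + n)) :
  #|[set t : 'S_(n + n) | diagram t == diagram s]| = diagram_mult n.
Proof.
rewrite /diagram_mult -[RHS](card_imset _ (mulIg s)); apply: eq_card => t.
rewrite inE; apply/eqP/imsetP=> [E|[u + ->]].
  by exists (t * s^-1)%g; rewrite ?mulgKV // inE diagram_mul E -diagram_mul mulgV.
by rewrite inE => /eqP E; rewrite diagram_mul E -diagram_mul mul1g.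
Qed.

Lemma sum_diagram (V : nmodType) n (F : {set {set vertex n}} -> V) :
  \sum_(s : 'S_(n + n)) F (diagram s) = (\sum_(mu in brauer n) F mu) *+ diagram_mult n.
Proof.
rewrite (partition_big (@diagram n) (mem (brauer n))) => [|s _]; last first.
  exact: diagram_brauer.
rewrite -sumrMnl; apply: eq_bigr => mu /brauer_diagram[s ->].
rewrite (eq_bigr (fun=> F (diagram s))) => [|t /eqP -> //].
by rewrite sumr_const -(card_diagram_fiber s); congr (_ *+ _); apply: eq_card => t;
  rewrite !inE.
Qed.

(** * Weights as products over edges *)

Definition lab n (L : labeling) (j : 'I_n) : 'I_n :=
  match L with Flab => j | Blab => rev_ord j end.

Lemma labK n L : involutive (@lab n L).
Proof. by case: L => // j; apply: rev_ordK. Qed.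

Lemma bot_labelE n L (j : 'I_n) : bot_label L j = bot (lab L j).
Proof. by case: L. Qed.

Definition is_top n (v : vertex n) : bool := if v is inl _ then true else false.

Definition label n (L : labeling) (v : vertex n) : 'I_n :=
  match v with inl i => i | inr j => lab L j end.

Definition edge_weight (A : comNzRingType) n (a b : 'I_n -> 'I_n -> A) L
    (u v : vertex n) : A :=
  let p := hat (label L u, label L v) in
  if is_top u == is_top v then b p.1 p.2 else a p.1 p.2.

Lemma hatC n (i j : 'I_n) : hat (i, j) = hat (j, i).
Proof. by rewrite /hat /=; case: ltngtP => // /val_inj ->. Qed.

Lemma hat_lt n (i j : 'I_n) : (i < j)%N -> hat (i, j) = (i, j).
Proof. by rewrite /hat /= => /ltnW ->. Qed.

Lemma hat_gt n (i j : 'I_n) : (j < i)%N -> hat (i, j) = (j, i).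
Proof. by move=> /hat_lt; rewrite hatC. Qed.

(** Passes from label pairs, as in [weight], to chords of one kind: [D] is the edge of a label pair,
    [h] the label pair of a chord, and [Q] selects the kind. *)
Lemma prod_edges (A : comNzRingType) n (s : 'S_(n + n)) (P : {set 'I_n * 'I_n})
    (Q : pred 'I_n) (D : 'I_n * 'I_n -> {set vertex n}) (h : 'I_n -> 'I_n * 'I_n)
    (F : 'I_n * 'I_n -> A) (G : 'I_n -> A) :
    (forall k, Q k -> [/\ h k \in P, D (h k) = edge s k & F (h k) = G k]) ->
    (forall p, p \in P -> exists2 k, Q k & D p = edge s k) ->
    {in P &, injective D} ->
  \prod_(p in P) F p = \prod_(k | Q k) G k.
Proof.
move=> hP PQ Dinj.
have hinj : {in Q &, injective h}.
  move=> i j /hP[_ Di _] /hP[_ Dj _] E.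
  by apply: (@edge_inj _ s); rewrite -Di -Dj E.
have -> : P = h @: Q.
  apply/setP=> p; apply/idP/imsetP=> [pP|[k Qk ->]]; last by have [] := hP k Qk.
  have [k Qk Dp] := PQ p pP; exists k => //; have [hk Dk _] := hP k Qk.
  by apply: Dinj => //; rewrite Dk.
by rewrite big_imset //=; apply: eq_bigr => k /hP[].
Qed.

Lemma weight_diagram (A : comNzRingType) n (a b : 'I_n -> 'I_n -> A) L
    (s : 'S_(n + n)) :
  weight a b L (diagram s) = \prod_k edge_weight a b L (lend s k) (rend s k).
Proof.
rewrite /weight.
pose G k := edge_weight a b L (lend s k) (rend s k).
pose T k := is_top (lend s k) && is_top (rend s k).
pose Bo k := ~~ is_top (lend s k) && ~~ is_top (rend s k).
pose X k := is_top (lend s k) != is_top (rend s k).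
have -> : \prod_k G k =
    \prod_(k | T k) G k * \prod_(k | Bo k) G k * \prod_(k | X k) G k.
  rewrite (bigID X) mulrC /=; congr (_ * _); rewrite (bigID T) /=.
  by congr (_ * _); apply: eq_bigl => k; rewrite /X /T /Bo; do 2!case: is_top.
have injs (f : 'I_n -> vertex n) : injective f ->
    {in [pred p : 'I_n * 'I_n | (p.1 < p.2)%N] &,
      injective (fun p => [set f p.1; f p.2])}.
  move=> finj [i j] [k l]; rewrite !inE /= => ij kl /set2_eq[] [/finj E1 /finj E2].
    by rewrite E1 E2.
  by subst; lia.
have binj : injective (bot_label L : 'I_n -> vertex n).
  by move=> i j; rewrite !bot_labelE => -[] /(can_inj (@labK n L)).
have tinj : injective (@top n) by move=> i j [].
pose h k := hat (label L (lend s k), label L (rend s k)).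
congr (_ * _ * _).
- apply: (@prod_edges _ _ s _ _ (fun p => [set top p.1; top p.2]) h).
  + move=> k; have := lend_neq_rend s k k; rewrite /T /G /h /cups /edge_weight.
    have := edge_diagram s k; rewrite /edge.
    case: (lend s k) => // i; case: (rend s k) => // j E ij _; rewrite inE /=.
    case: (ltngtP i j) => [lt|gt|/val_inj Eij]; last by rewrite Eij eqxx in ij.
      by rewrite hat_lt //= lt.
    by rewrite hat_gt //= gt setUC.
  + move=> [i j]; rewrite inE => /andP[_ /imsetP[k _ E]]; exists k => //.
    by case: (set2_eq E) => -[/= E1 E2]; rewrite /T -E1 -E2.
  + by move=> p q; rewrite !inE => /andP[p1 _] /andP[q1 _]; apply: injs.
- apply: (@prod_edges _ _ s _ _ (fun p => [set bot_label L p.1; bot_label L p.2]) h).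
  + move=> k; have := lend_neq_rend s k k; rewrite /Bo /G /h /caps /edge_weight.
    have := edge_diagram s k; rewrite /edge.
    case: (lend s k) => // i; case: (rend s k) => // j E ij _; rewrite inE /=.
    case: (ltngtP (lab L i) (lab L j)) => [lt|gt|/val_inj/(can_inj (@labK n L)) Eij].
    * by rewrite hat_lt //= lt !bot_labelE !labK.
    * by rewrite hat_gt //= gt !bot_labelE !labK setUC.
    * by rewrite Eij eqxx in ij.
  + move=> [i j]; rewrite inE => /andP[_ /imsetP[k _ E]]; exists k => //.
    by move: (set2_eq E); rewrite /= !bot_labelE /Bo => -[] [<- <-].
  + by move=> p q; rewrite !inE => /andP[p1 _] /andP[q1 _]; apply: injs.
(* Arcs list the top label first, whereas [h] sorts the labels; for arcs the sorting takes place
   inside the weight. *)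
- pose h' k := if is_top (lend s k) then (label L (lend s k), label L (rend s k))
               else (label L (rend s k), label L (lend s k)).
  apply: (@prod_edges _ _ s _ _ (fun p => [set top p.1; bot_label L p.2]) h').
  + move=> k; rewrite /X /G /h' /arcs /edge_weight.
    have := edge_diagram s k; rewrite /edge.
    case: (lend s k) => i; case: (rend s k) => // j E _; rewrite inE /=.
      by rewrite bot_labelE labK.
    by rewrite bot_labelE labK setUC hatC.
  + move=> [i j]; rewrite inE => /imsetP[k _ E]; exists k => //.
    by move: (set2_eq E); rewrite /= !bot_labelE /X => -[] [<- <-].
  + move=> [i j] [k l] _ _ /set2_eq[] [/= E1 E2]; last by rewrite bot_labelE in E1.
    by rewrite (tinj _ _ E1) (binj _ _ E2).
Qed.

(** The orientation signs of [matching_sign] turn the entries of [N] into edge weights; the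
    interleaving signs give the crossing sign. *)
Lemma diagram_term (A : comNzRingType) n (a b : 'I_n -> 'I_n -> A) L
    (N : 'I_(n + n) -> 'I_(n + n) -> A) :
    (forall x y, x != y ->
      edge_weight a b L (split x) (split y) =
      (-1) ^+ (pos (split y) < pos (split x))%N * N x y) ->
  forall s : 'S_(n + n),
    (-1) ^+ s * \prod_k N (s (lshift n k)) (s (rshift n k)) =
    (-1) ^+ chi (diagram s) * weight a b L (diagram s).
Proof.
move=> NE s; rewrite weight_diagram matching_sign chi_diagram mulrAC mulrC.
congr (_ * _); rewrite -big_split; apply: eq_bigr => k _ /=.
by rewrite /lend /rend NE // (inj_eq perm_inj) eq_lrshift.
Qed.

(** * Bottom labels as a permutation of the vertices *)

Definition relabel n L (x : 'I_(n + n)) : 'I_(n + n) :=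
  unsplit match split x with inl i => inl i | inr j => inr (lab L j) end.

Lemma relabel_inv n L : involutive (@relabel n L).
Proof.
move=> x; rewrite /relabel; case: (split_ordP x) => i ->; rewrite unsplitK //=.
by rewrite labK.
Qed.

Definition relabel_perm n L : 'S_(n + n) := perm (inv_inj (@relabel_inv n L)).

Lemma lend_relabel n L (k : 'I_n) : lend (relabel_perm n L) k = top k.
Proof. by rewrite /lend permE /relabel split_lshift unsplitK. Qed.

Lemma rend_relabel n L (k : 'I_n) : rend (relabel_perm n L) k = bot_label L k.
Proof. by rewrite /rend permE /relabel split_rshift unsplitK bot_labelE. Qed.

Lemma relabel_perm_F n : relabel_perm n Flab = 1%g.
Proof.
apply/perm.permP=> x; rewrite permE perm1 /relabel -[RHS]splitK.
by case: (split x).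
Qed.

(** Chord [i] joins the circular positions [i] and [n + i], so no chord is reversed and any two
    interleave. *)
Lemma sign_relabel_B (A : comNzRingType) n :
  (-1) ^+ relabel_perm n Blab = (-1) ^+ 'C(n, 2) :> A.
Proof.
rewrite matching_sign big1 ?mul1r => [|k _]; last first.
  rewrite lend_relabel rend_relabel /=.
  by have -> : (n + (n - (n - k.+1).+1) < k)%N = false by have := ltn_ord k; lia.
rewrite (exchange_big_dep xpredT) //= -bin2_sum big_mkord -prodrXr.
apply: eq_bigr => j _; transitivity (\prod_(i < j) (-1) : A); last first.
  by rewrite prodr_const card_ord.
rewrite (big_ord_widen n (fun=> -1)) ?(ltnW (ltn_ord j)) //.
apply: eq_bigr => i ij; rewrite !lend_relabel !rend_relabel /interleave /=.
have -> : (j < i)%N = false by lia.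
have -> : (n + (n - (n - j.+1).+1) < i)%N = false by have := ltn_ord i; lia.
have -> : (j < n + (n - (n - i.+1).+1))%N by have := ltn_ord j; lia.
have -> : (n + (n - (n - j.+1).+1) < n + (n - (n - i.+1).+1))%N = false.
  by have := ltn_ord j; lia.
by rewrite expr1.
Qed.

(** * The matrix whose Pfaffian sum counts diagrams *)

Definition symm_mx (A : comNzRingType) n (a : 'I_n -> 'I_n -> A) : 'M[A]_n :=
  \matrix_(i, j) a (hat (i, j)).1 (hat (i, j)).2.

Definition lower_mx (A : comNzRingType) n (b : 'I_n -> 'I_n -> A) : 'M[A]_n :=
  \matrix_(i, j) if (j < i)%N then b j i else 0.

(** The shape [X^T - X] is the one [pfsum_block] takes; a triangular [X] avoids dividing by 2. *)
Definition skew_mx (A : comNzRingType) n (b : 'I_n -> 'I_n -> A) : 'M[A]_n :=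
  (lower_mx b)^T - lower_mx b.

Lemma skew_mxE (A : comNzRingType) n (b : 'I_n -> 'I_n -> A) i j : i != j ->
  skew_mx b i j = (-1) ^+ (j < i)%N * b (hat (i, j)).1 (hat (i, j)).2.
Proof.
rewrite !mxE => ij; case: (ltngtP i j) => [lt|gt|/val_inj E].
- by rewrite hat_lt // mul1r subr0.
- by rewrite hat_gt // expr1 sub0r mulN1r.
- by rewrite E eqxx in ij.
Qed.

(** The value of [c^2] in each case. *)
Definition label_sign (A : comNzRingType) (L : labeling) : A :=
  if L is Flab then 1 else -1.

Definition brauer_mx (A : comNzRingType) n (a b : 'I_n -> 'I_n -> A) L :
    'M[A]_(n + n) :=
  block_mx (skew_mx b) (symm_mx a) (- symm_mx a) (- label_sign A L *: skew_mx b).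

(** Labels follow the circular order on the top row, and top precedes bottom. On the bottom row the
    circular order runs against the F labels and along the B labels, whence the factor
    [- label_sign A L]. *)
Lemma edge_weight_mx (A : comNzRingType) n (a b : 'I_n -> 'I_n -> A) L x y :
  x != y -> edge_weight a b L (split x) (split y) =
  (-1) ^+ (pos (split y) < pos (split x))%N *
  brauer_mx a b L (relabel_perm n L x) (relabel_perm n L y).
Proof.
rewrite !permE /relabel /edge_weight /brauer_mx /=.
case: (split_ordP x) => i ->; case: (split_ordP y) => j -> /=.
- rewrite (inj_eq (@lshift_inj _ _)) block_mxEul => ij.
  by rewrite skew_mxE // mulrA -signr_addb addbb mul1r.
- rewrite block_mxEur mxE => _.
  have -> : (n + (n - j.+1) < i)%N = false by have := ltn_ord i; lia.
  by rewrite mul1r.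
- rewrite block_mxEdl !mxE hatC => _.
  have -> : (j < n + (n - i.+1))%N by have := ltn_ord j; lia.
  by rewrite expr1 mulrNN mul1r.
- rewrite (inj_eq (@rshift_inj _ _)) block_mxEdr mxE => ij.
  rewrite skew_mxE ?(inj_eq (can_inj (@labK n L))) // !mulrA.
  have ni := ltn_ord i; have nj := ltn_ord j.
  rewrite [X in X * _](_ : _ = 1) ?mul1r //.
  rewrite mulrAC -signr_addb.
  have ij' : (i : nat) <> j by move/val_inj=> E; rewrite E eqxx in ij.
  case: L => /=.
    by rewrite [_ (+) _](_ : _ = true) ?mulrNN ?mulr1 //; lia.
  by rewrite [_ (+) _](_ : _ = false) ?opprK ?mulr1 //; lia.
Qed.

(** [brauer_mx] is indexed by labels and diagrams by positions; substituting [s * relabel_perm n L]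
    for [s] converts between them at the cost of a constant sign. *)
Lemma pfsum_brauer_mx (A : comNzRingType) n (a b : 'I_n -> 'I_n -> A) L :
  (-1) ^+ relabel_perm n L * pfsum (brauer_mx a b L) =
  (\sum_(mu in brauer n) (-1) ^+ chi mu * weight a b L mu) *+ diagram_mult n.
Proof.
rewrite -(sum_diagram (fun mu => (-1) ^+ chi mu * weight a b L mu)).
rewrite /pfsum (reindex_inj (mulIg (relabel_perm n L))) big_distrr /=.
apply: eq_bigr => s _; rewrite -(diagram_term (@edge_weight_mx _ _ a b L)) mulrA.
congr (_ * _); first by rewrite odd_permM signr_addb mulrCA -expr2 sqrr_sign mulr1.
by apply: eq_bigr => k _; rewrite !permM.
Qed.

(** The form is [brauer_mx] for [a] the identity and [b = 0]. Only permutations with the diagram of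
    the identity, all of whose edges are vertical, contribute, and each contributes 1. *)
Lemma pfsum_std_sympl (A : comNzRingType) n :
  pfsum (std_sympl A n) = (diagram_mult n)%:R.
Proof.
pose a (i j : 'I_n) : A := (i == j)%:R; pose b (i j : 'I_n) : A := 0.
have stdE : std_sympl A n = brauer_mx a b Flab.
  have K0 : skew_mx b = 0 by apply/matrixP=> i j; rewrite !mxE !if_same subr0.
  have S1 : symm_mx a = 1%:M.
    by apply/matrixP=> i j; rewrite !mxE /a /hat /=; case: ifP => // _; rewrite eq_sym.
  by rewrite /std_sympl /brauer_mx K0 S1 scaler0.
have term (s : 'S_(n + n)) :
    (-1) ^+ s * \prod_k std_sympl A n (s (lshift n k)) (s (rshift n k)) =
    (-1) ^+ chi (diagram s) * weight a b Flab (diagram s).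
  apply: diagram_term => x y xy; rewrite stdE edge_weight_mx //.
  by rewrite relabel_perm_F !perm1.
rewrite /pfsum /diagram_mult -sum1_card natr_sum [RHS]big_mkcond /=.
apply: eq_bigr => s _; rewrite inE; case: eqP => [E|/eqP NE].
  rewrite term E -term odd_perm1 mul1r big1 // => k _.
  by rewrite !perm1 block_mxEur mxE eqxx.
(* Both diagrams have [n] edges, so a different one has a chord that is not vertical, where the form
   vanishes. *)
have [k Dk] : exists k, edge s k \notin diagram 1%g.
  apply/existsP; rewrite -negb_forall; apply: contra NE => /forallP sub.
  rewrite eqEcard !card_diagram leqnn andbT.
  by apply/subsetP=> _ /imsetP[k _ ->].
suff N0 : std_sympl A n (s (lshift n k)) (s (rshift n k)) = 0.
  by rewrite (bigD1 k) //= N0 mul0r mulr0.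
have D1 (i : 'I_n) : [set top i; bot i] \in diagram 1%g.
  by have := edge_diagram (1%g : 'S_(n + n)) i; rewrite /edge /lend /rend !perm1
    split_lshift split_rshift.
move: Dk; rewrite /edge /lend /rend /std_sympl.
case: (split_ordP (s (lshift n k))) => i ->;
  case: (split_ordP (s (rshift n k))) => j ->.
- by rewrite block_mxEul mxE.
- rewrite block_mxEur mxE; case: eqP => // <-; by rewrite D1.
- rewrite block_mxEdl !mxE; case: eqP => [<-|]; first by rewrite setUC D1.
  by rewrite oppr0.
- by rewrite block_mxEdr mxE.
Qed.

(** * From Pfaffian sums to determinants *)

(** By [c^2 = label_sign A L], [pfsum_block] applies to [brauer_mx]: its Pfaffian sum is
    [diagram_mult n] times the determinant and, up to sign, as many times the diagram sum. Absence
    of torsion cancels the multiplicity. *)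
Lemma det_brauer (A : comNzRingType) n (a b : 'I_n -> 'I_n -> A) L (c : A) :
    (forall m, injective (fun x : A => x *+ m.+1)) -> c ^+ 2 = label_sign A L ->
  \det (symm_mx a + c *: skew_mx b) =
  (-1) ^+ relabel_perm n L *
  \sum_(mu in brauer n) (-1) ^+ chi mu * weight a b L mu.
Proof.
move=> tf c2; have [m mE] : exists m, diagram_mult n = m.+1.
  by exists (diagram_mult n).-1; rewrite prednK // diagram_mult_gt0.
apply: (tf m); rewrite -mE -mulrnAr -pfsum_brauer_mx mulrA -expr2 sqrr_sign mul1r.
rewrite /brauer_mx -c2 pfsum_block ?pfsum_std_sympl ?mulr_natr //.
by apply/matrixP=> i j; rewrite !mxE hatC.
Qed.

Theorem theorem1 (R : realType) (n : nat) (hn : (1 <= n)%N) :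
  \det (mat_F (@Xa R n) (@Xb R n)) =
    \sum_(mu in brauer n)
      (-1) ^+ chi mu * weight (@Xa R n) (@Xb R n) Flab mu
  /\
  \det (mat_B (sqrtm1 R n) (@Xa R n) (@Xb R n)) =
    (-1) ^+ 'C(n, 2) *
    \sum_(mu in brauer n)
      (-1) ^+ chi mu * weight (@Xa R n) (@Xb R n) Blab mu.
Proof.
(* Torsion-freeness is checked on coefficients, in characteristic 0. *)
have tf m : injective (fun x : polyring R n => x *+ m.+1).
  move=> p q /= E; apply/mpolyP=> k; apply: (@pmulrnI _ m.+1) => //=.
  by rewrite -!mcoeffMn E.
split.
- have -> : mat_F (@Xa R n) (@Xb R n) = symm_mx (@Xa R n) + 1 *: skew_mx (@Xb R n).
    apply/matrixP=> i j; rewrite scale1r !mxE.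
    case: (ltngtP i j) => [lt|gt|/val_inj ->].
    + by rewrite hat_lt // subr0.
    + by rewrite hat_gt // sub0r.
    + by rewrite /hat leqnn subr0 addr0.
  by rewrite (det_brauer _ _ (L := Flab)) ?expr1n // relabel_perm_F odd_perm1 mul1r.
- have -> : mat_B (sqrtm1 R n) (@Xa R n) (@Xb R n) =
      symm_mx (@Xa R n) + sqrtm1 R n *: skew_mx (@Xb R n).
    apply/matrixP=> i j; rewrite !mxE.
    case: (ltngtP i j) => [lt|gt|/val_inj ->].
    + by rewrite hat_lt // subr0.
    + by rewrite hat_gt // sub0r mulrN.
    + by rewrite /hat leqnn subr0 mulr0 addr0.
  rewrite (det_brauer _ _ (L := Blab)) ?sign_relabel_B //.
  by rewrite /sqrtm1 -rmorphXn /= sqr_i rmorphN1.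
Qed.
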